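(* Let $(\mathsf{M},\tau)$ and $(\mathsf{M}',\tau')$ be bounded Lorentzian metric spaces. Let $D$ be dense in $\mathsf{M}$ and let $\iota\colon D\to\mathsf{M}'$ be a distance-preserving map, i.e. $\tau(x,y)=\tau'(\iota(x),\iota(y))$ for all $x,y\in D$, whose image $\iota(D)$ is dense in $\mathsf{M}'$. Then $\iota$ extends uniquely to an isometry $\iota\colon\mathsf{M}\setminus\{i^0\}\to\mathsf{M}'\setminus\{i'^0\}$ (which, if desired, can be extended to the respective spacelike boundaries).
   Context: A bounded Lorentzian metric space is a pair $(\mathsf{M},\tau)$ of a nonempty set $\mathsf{M}$ and a function $\tau\colon\mathsf{M}^2\to[0,\infty)$ such that: (a) $\tau(x,y)+\tau(y,z)\le\tau(x,z)$ whenever $\tau(x,y)>0$ and $\tau(y,z)>0$; (b) there is a topology $T$ on $\mathsf{M}$ such that $\tau$ is continuous for the product topology $T^2$ and $\{\tau\ge\varepsilon\}\subset\mathsf{M}^2$ is compact for every $\varepsilon>0$; (c) for all distinct $x,y\in\mathsf{M}$ there is $z\in\mathsf{M}$ with $\tau(x,z)\ne\tau(y,z)$ or $\tau(z,x)\neq\tau(z,y)$. All topological notions on $\mathsf{M}$ (e.g. density) refer to the coarsest topology satisfying (b), which exists and is Polish. The spacelike boundary $i^0$ of $(\mathsf{M},\tau)$ is the (unique, if it exists) point with $\tau(i^0,x)=\tau(x,i^0)=0$ for every $x\in\mathsf{M}$; $i'^0$ denotes that of $(\mathsf{M}',\tau')$. If $\mathsf{M}$ has no spacelike boundary, $\mathsf{M}\setminus\{i^0\}$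 means $\mathsf{M}$, and likewise for $\mathsf{M}'$. If $i^0\in D$, ''extends'' refers to the restriction of $\iota$ to $D\setminus\{i^0\}$. An isometry is a bijective distance-preserving map. The parenthetical extension is the one given by $\iota(i^0):=i'^0$, where a missing spacelike boundary may be adjoined as an abstract point with $\tau$ (resp. $\tau'$) extended by zero to pairs involving it. *)

(* Defs.v *)
From HB Require Import structures.
From mathcomp Require Import all_boot all_order all_algebra.
From mathcomp Require Import all_classical all_reals all_analysis.
Set Implicit Arguments.
Unset Strict Implicit.
Unset Printing Implicit Defensive.
Import Order.TTheory GRing.Theory Num.Theory.
Import numFieldNormedType.Exports.
Local Open Scope classical_set_scope.
Local Open Scope ring_scope.

(* Condition (b) and "the coarsest topology" quantify over the topologies of
   one fixed set, so topologies are first-class values here; [topospace T]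
   gives access to the library's topological notions. *)
Record topology (M : Type) := Topology {
  opens :> set (set M) ;
  opens_setT : opens setT ;
  opens_setI : forall A B, opens A -> opens B -> opens (A `&` B) ;
  opens_bigcup : forall F : set (set M),
    F `<=` opens -> opens (\bigcup_(A in F) A) }.

Definition topospace (M : Type) (T : topology M) : Type := M.

Section TopoSpace.
Variables (M : Type) (T : topology M).

HB.instance Definition _ := gen_eqMixin (topospace T).
HB.instance Definition _ := gen_choiceMixin (topospace T).

Let opens_bigcupT (I : Type) (f : I -> set (topospace T)) :
  (forall i, opens T (f i)) -> opens T (\bigcup_i f i).
Proof.
move=> fT; have -> : \bigcup_i f i = \bigcup_(A in range f) A.
  by rewrite bigcup_image.
by apply: opens_bigcup => _ [i _ <-].
Qed.

HB.instance Definition _ := isOpenTopological.Build (topospace T)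
  (@opens_setT _ T) (@opens_setI _ T) opens_bigcupT.

End TopoSpace.

Section BoundedLorentzianMetricSpaces.
Variables (R : realType) (M : Type) (tau : M -> M -> R).

Definition admissible (T : topology M) : Prop :=
  continuous (fun p : topospace T * topospace T => tau p.1 p.2 : R) /\
  forall e : R, 0 < e ->
    compact [set p : topospace T * topospace T | e <= tau p.1 p.2].

Record bounded_Lorentzian_metric_space : Prop := {
  blms_nonempty : inhabited M ;
  blms_ge0 : forall x y, 0 <= tau x y ;
  blms_reverse_triangle : forall x y z,
    0 < tau x y -> 0 < tau y z -> tau x y + tau y z <= tau x z ;
  blms_topology : exists T : topology M, admissible T ;
  blms_distinguishes : forall x y, x <> y ->
    exists z, tau x z <> tau y z \/ tau z x <> tau z y }.

Definition coarsest_opens : set (set M) :=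
  [set A | forall T : topology M, admissible T -> opens T A].

Fact coarsest_setT : coarsest_opens setT.
Proof. by move=> T _; exact: opens_setT. Qed.

Fact coarsest_setI A B :
  coarsest_opens A -> coarsest_opens B -> coarsest_opens (A `&` B).
Proof. by move=> cA cB T aT; apply: opens_setI; [exact: cA|exact: cB]. Qed.

Fact coarsest_bigcup (F : set (set M)) :
  F `<=` coarsest_opens -> coarsest_opens (\bigcup_(A in F) A).
Proof. by move=> Fc T aT; apply: opens_bigcup => A /Fc; exact. Qed.

(* The intersection of all admissible topologies.  It is the coarsest one as
   soon as a coarsest one exists ([coarsest_topologyP]), which is always the
   case in a bounded Lorentzian metric space. *)
Definition coarsest_topology : topology M :=
  Topology coarsest_setT coarsest_setI coarsest_bigcup.

Lemma coarsest_topologyP (T : topology M) :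
  admissible T ->
  (forall T' : topology M, admissible T' -> opens T `<=` opens T') ->
  opens T = opens coarsest_topology.
Proof.
move=> aT leT; apply/seteqP; split=> A TA; last exact: TA.
by move=> T' aT'; exact: leT TA.
Qed.

Definition Ldense (D : set M) : Prop :=
  dense (D : set (topospace coarsest_topology)).

Definition spacelike_boundary (x : M) : Prop :=
  forall y, tau x y = 0 /\ tau y x = 0.

(* M \ {i^0}, which is M when there is no spacelike boundary. *)
Definition off_boundary : set M := ~` [set x | spacelike_boundary x].

Definition restrict_tau (A : set M) (x y : A) : R := tau (val x) (val y).

(* M together with its spacelike boundary: [None] is the adjoined point, and
   it is present only when M has no spacelike boundary of its own. *)
Definition with_boundary : set (option M) :=
  [set p | p = None -> ~ exists x, spacelike_boundary x].

Definition tau_with_boundary (p q : with_boundary) : R :=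
  match val p, val q with
  | Some x, Some y => tau x y
  | _, _ => 0
  end.

End BoundedLorentzianMetricSpaces.

Arguments restrict_tau {R M} tau A x y.
Arguments tau_with_boundary {R M} tau p q.

Definition distance_preserving (R : realType) (A B : Type)
    (tauA : A -> A -> R) (tauB : B -> B -> R) (f : A -> B) : Prop :=
  forall x y, tauA x y = tauB (f x) (f y).

Definition Lisometry (R : realType) (A B : Type)
    (tauA : A -> A -> R) (tauB : B -> B -> R) (f : A -> B) : Prop :=
  bijective f /\ distance_preserving tauA tauB f.

Definition extends (M M' : Type) (D E : set M) (E' : set M')
    (iota : D -> M') (j : E -> E') : Prop :=
  forall (x : D) (y : E), val x = val y -> iota x = val (j y).

(* Main.v *)
Require Import Defs.
From HB Require Import structures.
From mathcomp Require Import all_boot all_order all_algebra.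
From mathcomp Require Import all_classical all_reals all_analysis.
Import Order.TTheory GRing.Theory Num.Theory.
Import numFieldNormedType.Exports.
Set Implicit Arguments.
Unset Strict Implicit.
Unset Printing Implicit Defensive.
Local Open Scope classical_set_scope.
Local Open Scope ring_scope.

(** Call x in M and x' in M' matching if tau x d = tau' x' (iota d) and
    tau d x = tau' (iota d) x' for all d in D; by density and the
    distinction axiom each point has at most one match on the other side.
    If x is not the spacelike boundary, some d in D has tau x d > 0 or
    tau d x > 0, so the points of iota(D) coming from D near x eventually lie
    in a coordinate projection of a compact set {tau' >= e}; any cluster point
    matches x, and by continuity has the right distances to all matched
    points.  As D and iota(D) play symmetric roles, matching is the graph of
    the isometry. *)

(** Choice in both directions gives two functions, and the uniqueness conditions make them mutually
    inverse. *)
Lemma bijective_of_rel (A B : Type) (S : A -> B -> Prop) :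
  (forall x, exists y, S x y) -> (forall y, exists x, S x y) ->
  (forall x y y', S x y -> S x y' -> y = y') ->
  (forall x x' y, S x y -> S x' y -> x = x') ->
  exists f : A -> B, bijective f /\ forall x, S x (f x).
Proof.
move=> /choice[f Sf] /choice[g Sg] Sfun Sinj; exists f; split=> //.
exists g => [x|y]; first exact: Sinj (Sg _) (Sf _).
exact: Sfun (Sf _) (Sg _).
Qed.

(** The approximant is common because a cluster point only supplies, for each [e], some index at
    which both values are close. *)
Lemma eq_common_approx (R : realType) (u v : R) :
  (forall e, 0 < e -> exists w, `|u - w| < e /\ `|v - w| < e) -> u = v.
Proof.
move=> h; apply/eqP; rewrite -subr_eq0 -normr_le0; apply/ler_addgt0Pl => e e0.
have [|w [uw vw]] := h (e / 2); first by rewrite divr_gt0.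
rewrite addr0 (le_trans (ler_distD w _ _))// (splitr e) lerD ?(ltW uw)//.
by rewrite distrC ltW.
Qed.

(** * One-variable continuity and separation by a dense family *)

Section OneSpace.
Variables (R : realType) (M : Type) (tau : M -> M -> R).

Lemma admissible_continuousr (T : topology M) (x : M) : admissible tau T ->
  continuous (fun z : topospace T => tau x z : R).
Proof.
move=> [cT _] z; apply: (@continuous_comp _ _ _
  (fun z : topospace T => (x : topospace T, z))
  (fun p : topospace T * topospace T => tau p.1 p.2 : R)); last exact: cT.
exact: (cvg_pair (G := nbhs (x : topospace T)) (H := nbhs z) (cvg_cst _) cvg_id).
Qed.

Lemma admissible_continuousl (T : topology M) (x : M) : admissible tau T ->
  continuous (fun z : topospace T => tau z x : R).
Proof.
move=> [cT _] z; apply: (@continuous_comp _ _ _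
  (fun z : topospace T => (z, x : topospace T))
  (fun p : topospace T * topospace T => tau p.1 p.2 : R)); last exact: cT.
exact: (cvg_pair (G := nbhs z) (H := nbhs (x : topospace T)) cvg_id (cvg_cst _)).
Qed.

(** A preimage open in every admissible topology is open in their intersection. For joint continuity
    this argument fails: openness in all the product topologies does not by itself give openness in
    the product of the intersection. *)
Lemma coarsest_continuousr (x : M) :
  continuous (fun z : topospace (coarsest_topology tau) => tau x z : R).
Proof.
apply/continuousP => O oO.
change (coarsest_opens tau (tau x @^-1` O)) => T aT.
by move/continuousP: (@admissible_continuousr T x aT) => /(_ O oO).
Qed.

Lemma coarsest_continuousl (x : M) :
  continuous (fun z : topospace (coarsest_topology tau) => tau z x : R).
Proof.
apply/continuousP => O oO.
change (coarsest_opens tau (tau^~ x @^-1` O)) => T aT.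
by move/continuousP: (@admissible_continuousl T x aT) => /(_ O oO).
Qed.

Hypothesis hM : bounded_Lorentzian_metric_space tau.

Lemma blms_ext (x y : M) :
  (forall z, tau x z = tau y z) -> (forall z, tau z x = tau z y) -> x = y.
Proof.
move=> er el; apply: contrapT => /(blms_distinguishes hM)[z].
by rewrite er el => -[].
Qed.

Lemma spacelike_boundary_unique (x y : M) :
  spacelike_boundary tau x -> spacelike_boundary tau y -> x = y.
Proof.
by move=> bx b_y; apply: blms_ext => z;
  have [bx1 bx2] := bx z; have [by1 by2] := b_y z; congruence.
Qed.

Lemma off_boundaryP (x : M) :
  off_boundary tau x <-> exists y, 0 < tau x y \/ 0 < tau y x.
Proof.
split=> [nbx|[y yP] bx]; last first.
  by have [xy yx] := bx y; case: yP; rewrite ?xy ?yx ltxx.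
apply: contrapT => /forallNP nx; apply: nbx => y.
have /not_orP[/negP + /negP] := nx y.
by rewrite !lt_neqAle !(blms_ge0 hM) !andbT !negbK => /eqP <- /eqP <-.
Qed.

Section DenseFamily.
Variables (I : Type) (a : I -> M).
Hypothesis ha : Ldense tau (range a).

(** The set where [f] and [g] differ is open, so it would contain some [a i] if it were nonempty. *)
Lemma dense_eq (f g : M -> R) :
  continuous (f : topospace (coarsest_topology tau) -> R) ->
  continuous (g : topospace (coarsest_topology tau) -> R) ->
  (forall i, f (a i) = g (a i)) -> f = g.
Proof.
move=> cf cg fg; apply/funext => x; apply: contrapT => /eqP fgx.
pose h (z : topospace (coarsest_topology tau)) : R := f z - g z.
have ch : continuous h by move=> z; exact: cvgB (cf z) (cg z).
have oh : open (h @^-1` [set r | r != 0]).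
  by move/continuousP: ch; apply; exact: open_neq.
have [|z [hz [i _ iz]]] := ha _ oh; first by exists x; rewrite /= subr_eq0.
by move: hz; rewrite -iz /h /= fg subrr eqxx.
Qed.

Lemma dense_ext (x y : M) : (forall i, tau x (a i) = tau y (a i)) ->
  (forall i, tau (a i) x = tau (a i) y) -> x = y.
Proof.
move=> er el; apply: blms_ext => z.
  by have /(congr1 (@^~ z)) := dense_eq
    (@coarsest_continuousr x) (@coarsest_continuousr y) er.
by have /(congr1 (@^~ z)) := dense_eq
  (@coarsest_continuousl x) (@coarsest_continuousl y) el.
Qed.

(** Otherwise both distance functions of [x] vanish on a dense set, hence everywhere. The positive
    distance found here later fixes the level of a compact set. *)
Lemma off_boundary_denseP (x : M) : off_boundary tau x <->
  exists i, 0 < tau x (a i) \/ 0 < tau (a i) x.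
Proof.
split=> [/off_boundaryP[y yP]|[i iP]]; last by apply/off_boundaryP; exists (a i).
have c0 : continuous
    ((fun=> 0) : topospace (coarsest_topology tau) -> R).
  exact: (@cst_continuous (topospace (coarsest_topology tau)) R 0).
apply: contrapT => /forallNP nx.
have n0 i : tau x (a i) = 0 /\ tau (a i) x = 0.
  have /not_orP[/negP + /negP] := nx i.
  by rewrite !lt_neqAle !(blms_ge0 hM) !andbT !negbK => /eqP <- /eqP <-.
have /(congr1 (@^~ y)) r0 := dense_eq
  (@coarsest_continuousr x) c0 (fun i => proj1 (n0 i)).
have /(congr1 (@^~ y)) l0 := dense_eq
  (@coarsest_continuousl x) c0 (fun i => proj2 (n0 i)).
by move: yP; rewrite r0 l0 ltxx => -[].
Qed.

End DenseFamily.

End OneSpace.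

(* D -> M and iota are replaced by two families a, b over a common index type,
   which makes the two spaces interchangeable. *)
Definition matching (R : realType) (M M' I : Type) (tau : M -> M -> R)
    (tau' : M' -> M' -> R) (a : I -> M) (b : I -> M') (x : M) (x' : M') :=
  forall i, tau x (a i) = tau' x' (b i) /\ tau (a i) x = tau' (b i) x'.

(** * Matching points of the two spaces *)

Section Matching.
Variables (R : realType) (M M' I : Type).
Variables (tau : M -> M -> R) (tau' : M' -> M' -> R).
Hypotheses (hM : bounded_Lorentzian_metric_space tau)
           (hM' : bounded_Lorentzian_metric_space tau').
Variables (a : I -> M) (b : I -> M').
Hypotheses (ha : Ldense tau (range a)) (hb : Ldense tau' (range b)).
Hypothesis hab : forall i k, tau (a i) (a k) = tau' (b i) (b k).

Let rel := matching tau tau' a b.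

Lemma matching_fun (x : M) (x' y' : M') : rel x x' -> rel x y' -> x' = y'.
Proof.
by move=> rx ry; apply: (dense_ext hM' hb) => i;
  have [e1 e2] := rx i; have [e3 e4] := ry i; congruence.
Qed.

(** Being off the boundary is detected on the dense families, where matching points have equal
    distances. *)
Lemma matching_off_boundary (x : M) (x' : M') :
  rel x x' -> off_boundary tau x <-> off_boundary tau' x'.
Proof.
move=> rx; split=> [/(off_boundary_denseP hM ha)|/(off_boundary_denseP hM' hb)]
  [i iP]; [apply/(off_boundary_denseP hM' hb)|apply/(off_boundary_denseP hM ha)];
  exists i; have [e1 e2] := rx i; first by rewrite -e1 -e2.
by rewrite e1 e2.
Qed.

(* Density of the range of a is only known for the coarsest topology, hence
   the neighbourhoods are taken there. *)
Let trace (x : M) : set_system I :=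
  filter_from (nbhs (x : topospace (coarsest_topology tau)))
    (fun U => a @^-1` U).

Let trace_proper (x : M) : ProperFilter (trace x).
Proof.
apply: filter_from_proper => [|U].
  apply: filter_from_filter; first by exists setT; exact: filterT.
  by move=> U V nU nV; exists (U `&` V) => //; exact: filterI.
rewrite nbhsE => -[V [oV Vx] VU].
have [|z [Vz [i _ iz]]] := ha _ oV; first by exists x.
by exists i; apply: VU; rewrite iz.
Qed.

(** The point [x'] is a cluster point of the [b k] as [a k] tends to [x]. Testing it against all
    matched pairs, not only the [(a i, b i)], later gives preservation of distances as well. *)
Lemma matching_exists (x : M) : off_boundary tau x ->
  exists x', forall y y', rel y y' ->
    tau x y = tau' x' y' /\ tau y x = tau' y' x'.
Proof.
move=> /(off_boundary_denseP hM ha)[i iP].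
(* Compactness is available in an admissible topology; the intersection of them all is not shown
   here to be one. *)
have [T' aT'] := blms_topology hM'.
pose G : set_system (topospace T') := b @ trace x.
have [K cK GK] : exists2 K : set (topospace T'), compact K & G K.
  (* Half of the positive distance leaves room: for [a k] near [x] the distance between [a k] and
     [a i] stays above it, so [(b k, b i)] or [(b i, b k)] lies in a compact set, which is then
     projected. *)
  case: iP => p; have e0 := divr_gt0 p (ltr0Sn R 1).
  - exists (fst @` [set q : topospace T' * topospace T' |
        tau x (a i) / 2 <= tau' q.1 q.2]).
      apply: continuous_compact; last exact: aT'.2 e0.
      apply: continuous_subspaceT => q.
      exact: (cvg_fst (F := nbhs q.1) (G := nbhs q.2)).
    exists [set z | tau x (a i) / 2 < tau z (a i)].
      have half : tau x (a i) / 2 < tau x (a i).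
        by rewrite ltr_pdivrMr// ltr_pMr// ltr1n.
      exact: (@coarsest_continuousl _ _ tau (a i) x _ (lt_nbhsr half)).
    move=> k /= /ltW; rewrite hab => kP.
    by exists (b k, b i).
  - exists (snd @` [set q : topospace T' * topospace T' |
        tau (a i) x / 2 <= tau' q.1 q.2]).
      apply: continuous_compact; last exact: aT'.2 e0.
      apply: continuous_subspaceT => q.
      exact: (cvg_snd (F := nbhs q.1) (G := nbhs q.2)).
    exists [set z | tau (a i) x / 2 < tau (a i) z].
      have half : tau (a i) x / 2 < tau (a i) x.
        by rewrite ltr_pdivrMr// ltr_pMr// ltr1n.
      exact: (@coarsest_continuousr _ _ tau (a i) x _ (lt_nbhsr half)).
    move=> k /= /ltW; rewrite hab => kP.
    by exists (b i, b k).
have GP : ProperFilter G by exact: fmap_proper_filter (trace_proper x).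
have [x' [_ clx']] := cK G GP GK.
(* The [b k] with [f (a k)] close to [f x] form a set in [G], which meets every neighbourhood of
   [x']; the common value [f (a k) = g (b k)] then approximates both sides. *)
have lim (f : topospace (coarsest_topology tau) -> R) (g : topospace T' -> R) :
    continuous f -> continuous g -> (forall k, f (a k) = g (b k)) ->
    f x = g x'.
  move=> cf cg fg; apply: eq_common_approx => e e0.
  have Gf : G (b @` [set k | `|f x - f (a k)| < e]).
    exists [set z | `|f x - f z| < e].
      exact: (cf x _ (nbhsx_ballx (f x) e e0)).
    by move=> k /= kP; exists k.
  have [z [[k /= kP <-] zP]] := clx' _ [set z | `|g x' - g z| < e] Gf
    (cg x' _ (nbhsx_ballx (g x') e e0)).
  by exists (f (a k)); split=> //; rewrite fg.
exists x' => y y' ryy'; split.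
  apply: (lim (tau^~ y) (tau'^~ y')) => [||k].
  - exact: coarsest_continuousl.
  - exact: admissible_continuousl.
  - exact: (ryy' k).2.
apply: (lim (tau y) (tau' y')) => [||k].
- exact: coarsest_continuousr.
- exact: admissible_continuousr.
- exact: (ryy' k).1.
Qed.

Lemma matching_refl (i : I) : rel (a i) (b i).
Proof. by move=> k; rewrite !hab. Qed.

Lemma matching_total (x : off_boundary tau) :
  exists x' : off_boundary tau', rel (val x) (val x').
Proof.
have [x' x'P] := matching_exists (set_valP x).
have rx : rel (val x) x' by move=> i; exact: x'P (matching_refl i).
have ox' : off_boundary tau' x'.
  by apply/(matching_off_boundary rx); exact: set_valP.
by exists (SigSub (mem_set ox')).
Qed.

(** Matching only compares distances to the families; [matching_exists] gives a match of [x] that is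
    right against every matched pair, and uniqueness identifies it with [x']. *)
Lemma matching_tau (x y : off_boundary tau) (x' y' : M') :
  rel (val x) x' -> rel (val y) y' -> tau (val x) (val y) = tau' x' y'.
Proof.
move=> rx ry; have [z' z'P] := matching_exists (set_valP x).
have rz : rel (val x) z' by move=> i; exact: z'P (matching_refl i).
by rewrite (matching_fun rx rz); exact: (z'P _ _ ry).1.
Qed.

End Matching.

Lemma matching_sym (R : realType) (M M' I : Type) (tau : M -> M -> R)
    (tau' : M' -> M' -> R) (a : I -> M) (b : I -> M') (x : M) (x' : M') :
  matching tau tau' a b x x' -> matching tau' tau b a x' x.
Proof. by move=> r i; have [-> ->] := r i. Qed.

(** * Adjoining spacelike boundaries *)

Section WithBoundary.
Variables (R : realType) (M : Type) (tau : M -> M -> R).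

Lemma with_boundary_Some (x : M) : exists p : with_boundary tau, val p = Some x.
Proof.
have wx : with_boundary tau (Some x) by [].
by exists (SigSub (mem_set wx)).
Qed.

Lemma with_boundary_None (p : with_boundary tau) :
  val p = None -> ~ exists x, spacelike_boundary tau x.
Proof. by move=> p0; exact: (set_valP p) p0. Qed.

Lemma spacelike_boundary_Some (x : M) (p : with_boundary tau) :
  val p = Some x ->
  spacelike_boundary (tau_with_boundary tau) p <-> spacelike_boundary tau x.
Proof.
move=> px; split=> [bp y|bx q]; last first.
  by rewrite /tau_with_boundary px; case: (val q) => [y|//]; exact: bx.
have [q qy] := with_boundary_Some y.
by have := bp q; rewrite /tau_with_boundary px qy.
Qed.

Lemma with_boundary_spec (p : with_boundary tau) :
  (exists x : off_boundary tau, val p = Some (val x)) \/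
  spacelike_boundary (tau_with_boundary tau) p.
Proof.
case px : (val p) => [x|]; last first.
  by right=> q; rewrite /tau_with_boundary px; case: (val q).
have [bx|ox] := pselect (spacelike_boundary tau x).
  by right; apply/(spacelike_boundary_Some (x := x)).
have ox' : off_boundary tau x by [].
by left; exists (SigSub (mem_set ox')).
Qed.

Lemma spacelike_boundary_off (p : with_boundary tau) (x : off_boundary tau) :
  val p = Some (val x) -> ~ spacelike_boundary (tau_with_boundary tau) p.
Proof. by move=> px /(spacelike_boundary_Some px); exact: (set_valP x). Qed.

Lemma spacelike_boundary_exists :
  exists p : with_boundary tau, spacelike_boundary (tau_with_boundary tau) p.
Proof.
have [[x bx]|nb] := pselect (exists x, spacelike_boundary tau x).
  have [p px] := with_boundary_Some x.
  by exists p; apply/(spacelike_boundary_Some (x := x)).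
have w0 : with_boundary tau None by [].
by exists (SigSub (mem_set w0)) => q; rewrite /tau_with_boundary; case: (val q).
Qed.

Hypothesis hM : bounded_Lorentzian_metric_space tau.

(** A genuine boundary point and the adjoined [None] exclude each other; two genuine ones coincide
    by the distinction axiom. *)
Lemma spacelike_boundary_with_boundary_unique (p q : with_boundary tau) :
  spacelike_boundary (tau_with_boundary tau) p ->
  spacelike_boundary (tau_with_boundary tau) q -> p = q.
Proof.
move=> bp bq; apply: val_inj.
case px : (val p) => [x|]; case qy : (val q) => [y|] //.
- congr Some; apply: (spacelike_boundary_unique hM).
    exact/(spacelike_boundary_Some px).
  exact/(spacelike_boundary_Some qy).
- by case: (with_boundary_None qy); exists x;
    exact/(spacelike_boundary_Some px).
- by case: (with_boundary_None px); exists y;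
    exact/(spacelike_boundary_Some qy).
Qed.

End WithBoundary.

(** The graph of [J] follows [j] off the boundary and pairs boundary with boundary, which treats all
    combinations of genuine and adjoined boundary points at once. *)
Lemma Lisometry_with_boundary (R : realType) (M M' : Type)
    (tau : M -> M -> R) (tau' : M' -> M' -> R)
    (hM : bounded_Lorentzian_metric_space tau)
    (hM' : bounded_Lorentzian_metric_space tau')
    (j : off_boundary tau -> off_boundary tau') :
  Lisometry (restrict_tau tau (off_boundary tau))
    (restrict_tau tau' (off_boundary tau')) j ->
  exists J : with_boundary tau -> with_boundary tau',
    [/\ Lisometry (tau_with_boundary tau) (tau_with_boundary tau') J,
        forall (x : off_boundary tau) (p : with_boundary tau),
          val p = Some (val x) -> val (J p) = Some (val (j x)) &
        forall p : with_boundary tau,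
          spacelike_boundary (tau_with_boundary tau) p ->
          spacelike_boundary (tau_with_boundary tau') (J p)].
Proof.
move=> [[k jK kK] dj].
pose S (p : with_boundary tau) (q : with_boundary tau') :=
  (exists x, val p = Some (val x) /\ val q = Some (val (j x))) \/
  (spacelike_boundary (tau_with_boundary tau) p /\
   spacelike_boundary (tau_with_boundary tau') q).
have [p|q|p q q'|p p' q|J [bJ SJ]] := @bijective_of_rel _ _ S.
- have [[x px]|bp] := with_boundary_spec p.
    have [q qx] := with_boundary_Some tau' (val (j x)).
    by exists q; left; exists x.
  by have [q bq] := spacelike_boundary_exists tau'; exists q; right.
- have [[y qy]|bq] := with_boundary_spec q.
    have [p px] := with_boundary_Some tau (val (k y)).
    by exists p; left; exists (k y); rewrite kK.
  by have [p bp] := spacelike_boundary_exists tau; exists p; right.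
- case=> [[x [px qx]]|[bp bq]] [[y [py qy]]|[bp' bq']].
  + move: py; rewrite px => -[/val_inj xy].
    by apply: val_inj; rewrite qx qy xy.
  + by case: (spacelike_boundary_off px bp').
  + by case: (spacelike_boundary_off py bp).
  + exact: (spacelike_boundary_with_boundary_unique hM').
- case=> [[x [px qx]]|[bp bq]] [[y [py qy]]|[bp' bq']].
  + move: qy; rewrite qx => -[/val_inj/(can_inj jK) xy].
    by apply: val_inj; rewrite px py xy.
  + by case: (spacelike_boundary_off qx bq').
  + by case: (spacelike_boundary_off qy bq).
  + exact: (spacelike_boundary_with_boundary_unique hM).
exists J; split.
- split=> // p q.
  (* If either point is a boundary, so is its image, and both distances are zero. *)
  case: (SJ p) => [[x [px Jpx]]|[bp bJp]]; last first.
    by rewrite (bp q).1 (bJp (J q)).1.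
  case: (SJ q) => [[y [qy Jqy]]|[bq bJq]]; last first.
    by rewrite (bq p).2 (bJq (J p)).2.
  by rewrite /tau_with_boundary px qy Jpx Jqy; exact: dj.
- move=> x p px; case: (SJ p) => [[y [py Jpy]]|[bp _]]; last first.
    by case: (spacelike_boundary_off px bp).
  by move: py; rewrite px => -[/val_inj ->].
- move=> p bp; case: (SJ p) => [[y [py _]]|[]//].
  by case: (spacelike_boundary_off py bp).
Qed.

Theorem lemma2p13 (R : realType) (M M' : Type)
    (tau : M -> M -> R) (tau' : M' -> M' -> R)
    (hM : bounded_Lorentzian_metric_space tau)
    (hM' : bounded_Lorentzian_metric_space tau')
    (D : set M) (iota : D -> M')
    (hD : Ldense tau D)
    (hiota : distance_preserving (restrict_tau tau D) tau' iota)
    (himage : Ldense tau' (range iota)) :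
  exists j : off_boundary tau -> off_boundary tau',
    unique (fun f : off_boundary tau -> off_boundary tau' =>
              Lisometry (restrict_tau tau (off_boundary tau))
                       (restrict_tau tau' (off_boundary tau')) f /\
              extends iota f) j /\
    exists J : with_boundary tau -> with_boundary tau',
      [/\ Lisometry (tau_with_boundary tau)
                   (tau_with_boundary tau') J,
          forall (x : off_boundary tau) (p : with_boundary tau),
            val p = Some (val x) -> val (J p) = Some (val (j x)) &
          forall p : with_boundary tau,
            spacelike_boundary (tau_with_boundary tau) p ->
            spacelike_boundary (tau_with_boundary tau') (J p)].
Proof.
pose a (d : D) : M := val d.
have ha : Ldense tau (range a).
  move=> O O0 oO; have [x [Ox Dx]] := hD O O0 oO.
  by exists x; split=> //; exists (SigSub (mem_set Dx)).
have hab d e : tau (a d) (a e) = tau' (iota d) (iota e) by exact: hiota.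
have hba d e : tau' (iota d) (iota e) = tau (a d) (a e) by [].
pose rel := matching tau tau' a iota.
have relF (x : M) (y z : M') : rel x y -> rel x z -> y = z.
  exact: matching_fun.
have relI (x y : M) (z : M') : rel x z -> rel y z -> x = y.
  move=> rx ry.
  exact: (matching_fun hM ha (matching_sym rx) (matching_sym ry)).
have [x|y|x y y' rx ry|x x' y rx ry|j [bj rj]] := @bijective_of_rel
  (off_boundary tau) (off_boundary tau') (fun x y => rel (val x) (val y)).
- exact: (matching_total hM hM' ha himage hab).
- have [x rx] := matching_total hM' hM himage ha hba y.
  by exists x; exact: matching_sym.
- exact: val_inj (relF _ _ _ rx ry).
- exact: val_inj (relI _ _ _ rx ry).
have isoj : Lisometry (restrict_tau tau (off_boundary tau))
    (restrict_tau tau' (off_boundary tau')) j.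
  split=> // x y.
  exact: (matching_tau hM hM' ha himage hab (rj x) (rj y)).
have relD d : rel (a d) (iota d) by exact: matching_refl.
exists j; split; last exact: Lisometry_with_boundary.
split=> [|f [[_ df] ef]].
  split=> // d x dx; apply: relF (rj x).
  by rewrite -dx; exact: relD.
(* Uniqueness: a competitor [f x] is shown to match [x] too. *)
apply/funext => x; apply: val_inj; apply: relF (rj x) _ => d.
(* The hypothesis [ef] says nothing at a boundary point of [D]; there [iota d] is a boundary as
   well, and all the distances vanish. *)
have [bd|od] := pselect (spacelike_boundary tau (a d)).
  have bd' : spacelike_boundary tau' (iota d).
    apply: contrapT => od'.
    by have /(_ bd) := (matching_off_boundary hM hM' ha himage (relD d)).2 od'.
  by have [-> ->] := bd (val x); have [-> ->] := bd' (val (f x)).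
pose e : off_boundary tau := SigSub (mem_set (od : off_boundary tau (a d))).
have -> : iota d = val (f e) by exact: ef.
by split; [exact: (df x e)|exact: (df e x)].
Qed.
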